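(* There exist $2^{\mathfrak{c}}$ pairwise non-homeomorphic topologies $\tau\in\mathcal{L}$ such that $(\mathbb{R},\tau)$ is a completely normal space of first category (i.e. a meager space).
   Context: $\mathfrak{c}=|\mathbb{R}|$. $\eta$ denotes the Euclidean topology on $\mathbb{R}$. $\mathcal{L}$ denotes the family of all Hausdorff topologies $\tau$ on the set $\mathbb{R}$ with $\tau\subset\eta$. *)

(* Defs.v *)
From Stdlib Require Import Reals.
Open Scope R_scope.

Definition is_topology (tau : (R -> Prop) -> Prop) : Prop :=
  tau (fun _ => False) /\ tau (fun _ => True) /\
  (forall F : (R -> Prop) -> Prop,
      (forall U, F U -> tau U) -> tau (fun x => exists U, F U /\ U x)) /\
  (forall U V, tau U -> tau V -> tau (fun x => U x /\ V x)).

Definition euclid_open (U : R -> Prop) : Prop :=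
  forall x, U x -> exists e, 0 < e /\ forall y, Rabs (y - x) < e -> U y.

Definition coarser (tau sigma : (R -> Prop) -> Prop) : Prop :=
  forall U, tau U -> sigma U.

Definition hausdorff (tau : (R -> Prop) -> Prop) : Prop :=
  forall x y, x <> y -> exists U V, tau U /\ tau V /\ U x /\ V y /\
    (forall z, U z -> V z -> False).

Definition in_L (tau : (R -> Prop) -> Prop) : Prop :=
  is_topology tau /\ hausdorff tau /\ coarser tau euclid_open.

Definition closure (tau : (R -> Prop) -> Prop) (A : R -> Prop) : R -> Prop :=
  fun x => forall U, tau U -> U x -> exists y, U y /\ A y.

Definition interior (tau : (R -> Prop) -> Prop) (A : R -> Prop) : R -> Prop :=
  fun x => exists U, tau U /\ U x /\ (forall y, U y -> A y).

Definition completely_normal (tau : (R -> Prop) -> Prop) : Prop :=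
  forall A B : R -> Prop,
    (forall x, closure tau A x -> B x -> False) ->
    (forall x, A x -> closure tau B x -> False) ->
    exists U V, tau U /\ tau V /\ (forall x, A x -> U x) /\
      (forall x, B x -> V x) /\ (forall z, U z -> V z -> False).

Definition nowhere_dense (tau : (R -> Prop) -> Prop) (A : R -> Prop) : Prop :=
  forall x, ~ interior tau (closure tau A) x.

Definition first_category (tau : (R -> Prop) -> Prop) : Prop :=
  exists N : nat -> (R -> Prop),
    (forall n, nowhere_dense tau (N n)) /\ (forall x, exists n, N n x).

Definition homeomorphic (tau1 tau2 : (R -> Prop) -> Prop) : Prop :=
  exists f g : R -> R,
    (forall x, g (f x) = x) /\ (forall y, f (g y) = y) /\
    (forall U, tau2 U -> tau1 (fun x => U (f x))) /\
    (forall U, tau1 U -> tau2 (fun y => U (g y))).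

(* Main.v *)
Require Import Defs.
From Stdlib Require Import Reals Lra Lia ZArith List Cantor.
From Stdlib Require Import Classical ClassicalEpsilon FunctionalExtensionality PropExtensionality.

(** Wind the line densely around the torus by [t |-> (t mod 1, sqrt 2 * t mod 1)]:
    the induced topology on R is coarser than the Euclidean one, and every
    [[-n, n]] is closed in it with empty interior, because the line returns
    arbitrarily late to any neighbourhood of each of its points.  The integers [x_k]
    from the Pell equation [p^2 - 8 x^2 = 1] converge on the torus to the point (0, 1/2)
    off the line, so they form a closed discrete set.  A free filter F on the indices
    then yields a coarser topology in which a neighbourhood of 0 must also contain
    [x_k] for an F-large set of [k]; it determines F, and it remains completely normal
    and of first category.  An almost disjoint family of size continuum provides
    2^c filters.  Since a homeomorphism onto a fixed Hausdorff space is determined by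
    its values on a dense sequence, each homeomorphism class among these topologies has
    at most c members; a König-type diagonal argument then extracts 2^c topologies in
    distinct classes. *)

(** * The winding topology *)

(** The point of parameter [t] on the torus lies within [e] of the origin in the sup metric; [p] and
    [q] account for reduction mod 1. *)
Definition near (e t : R) : Prop :=
  exists p q : Z, Rabs (t - IZR p) < e /\ Rabs (sqrt 2 * t - IZR q) < e.

Definition winding_open (U : R -> Prop) : Prop :=
  forall x, U x -> exists e, 0 < e /\ forall y, near e (y - x) -> U y.

Lemma sqrt2_bounds : 1 < sqrt 2 < 3/2.
Proof.
  assert (H := sqrt_sqrt 2 ltac:(lra)). assert (H0 := sqrt_pos 2). split; nra.
Qed.

Lemma Rabs_lt_iff (x e : R) : Rabs x < e <-> - e < x < e.
Proof. split; [intros H; apply Rabs_def2 in H; lra | intros [? ?]; now apply Rabs_def1]. Qed.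

Lemma near_of_small (e t : R) : Rabs t < e / 2 -> near e t.
Proof.
  intros H. exists 0%Z, 0%Z. assert (S := sqrt2_bounds).
  apply Rabs_lt_iff in H. split; apply Rabs_lt_iff; split; nra.
Qed.

Lemma near_zero (e : R) : 0 < e -> near e 0.
Proof. intros H. apply near_of_small. rewrite Rabs_R0. lra. Qed.

Lemma near_mono (e e' t : R) : e <= e' -> near e t -> near e' t.
Proof. intros H (p & q & Hp & Hq). exists p, q. split; lra. Qed.

Lemma near_opp (e t : R) : near e t -> near e (- t).
Proof.
  intros (p & q & Hp & Hq). exists (- p)%Z, (- q)%Z. rewrite !opp_IZR.
  rewrite Rabs_lt_iff in Hp, Hq. split; apply Rabs_lt_iff; lra.
Qed.

Lemma near_sym (e x y : R) : near e (x - y) -> near e (y - x).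
Proof. intros H. replace (y - x) with (- (x - y)) by ring. now apply near_opp. Qed.

Lemma near_add (e e' s t : R) : near e s -> near e' t -> near (e + e') (s + t).
Proof.
  intros (p & q & Hp & Hq) (p' & q' & Hp' & Hq').
  exists (p + p')%Z, (q + q')%Z. rewrite !plus_IZR.
  rewrite Rabs_lt_iff in Hp, Hq, Hp', Hq'. split; apply Rabs_lt_iff; lra.
Qed.

Lemma near_triangle (e e' x y z : R) :
  near e (y - x) -> near e' (z - y) -> near (e + e') (z - x).
Proof.
  intros H H'. replace (z - x) with ((y - x) + (z - y)) by ring. now apply near_add.
Qed.

Lemma near_slack (e t : R) : near e t -> exists d, 0 < d /\ near (e - d) t.
Proof.
  intros (p & q & Hp & Hq).
  set (m := Rmax (Rabs (t - IZR p)) (Rabs (sqrt 2 * t - IZR q))).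
  assert (m < e) by (now apply Rmax_lub_lt).
  assert (A := Rmax_l (Rabs (t - IZR p)) (Rabs (sqrt 2 * t - IZR q))).
  assert (B := Rmax_r (Rabs (t - IZR p)) (Rabs (sqrt 2 * t - IZR q))).
  fold m in A, B.
  exists ((e - m) / 2). split; [lra|]. exists p, q. split; lra.
Qed.

Lemma near_ball_open (e x : R) : winding_open (fun y => near e (y - x)).
Proof.
  intros y Hy. destruct (near_slack _ _ Hy) as (d & Hd & H).
  exists d. split; [exact Hd|]. intros z Hz.
  replace e with ((e - d) + d) by ring. eapply near_triangle; eassumption.
Qed.

Lemma winding_open_union (F : (R -> Prop) -> Prop) :
  (forall U, F U -> winding_open U) -> winding_open (fun x => exists U, F U /\ U x).
Proof.
  intros H x (U & FU & Ux). destruct (H U FU x Ux) as (e & He & K).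
  exists e. split; [exact He|]. intros y Hy. exists U. auto.
Qed.

Lemma winding_open_inter (U V : R -> Prop) :
  winding_open U -> winding_open V -> winding_open (fun x => U x /\ V x).
Proof.
  intros HU HV x [Ux Vx].
  destruct (HU x Ux) as (e & He & K). destruct (HV x Vx) as (e' & He' & K').
  exists (Rmin e e'). split; [now apply Rmin_pos|]. intros y Hy. split.
  - apply K. eapply near_mono; [apply Rmin_l | exact Hy].
  - apply K'. eapply near_mono; [apply Rmin_r | exact Hy].
Qed.

Lemma winding_open_euclid (U : R -> Prop) : winding_open U -> euclid_open U.
Proof.
  intros H x Ux. destruct (H x Ux) as (e & He & K). exists (e / 2). split; [lra|].
  intros y Hy. apply K. now apply near_of_small.
Qed.

(* The factor [1/2] makes the balls around a point of A and a point of B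
   disjoint, as the larger of the two radii would otherwise reach the other
   centre. *)
Lemma winding_separation (A B : R -> Prop) :
  (forall a, A a -> exists e, 0 < e /\ forall b, near e (b - a) -> ~ B b) ->
  (forall b, B b -> exists e, 0 < e /\ forall a, near e (a - b) -> ~ A a) ->
  exists U V, winding_open U /\ winding_open V /\
    (forall x, A x -> U x) /\ (forall x, B x -> V x) /\
    (forall z, U z -> V z -> False).
Proof.
  set (W := fun (A B : R -> Prop) z => exists S, (exists a e, A a /\
        (forall b, near e (b - a) -> ~ B b) /\ S = (fun z => near (e / 2) (z - a))) /\ S z).
  assert (WO : forall A B, winding_open (W A B)).
  { intros A' B'. apply winding_open_union. intros S (a & e & _ & _ & ->).
    apply near_ball_open. }
  assert (WI : forall A B : R -> Prop,
    (forall a, A a -> exists e, 0 < e /\ forall b, near e (b - a) -> ~ B b) ->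
    forall x, A x -> W A B x).
  { intros A' B' H x Ax. destruct (H x Ax) as (e & He & K).
    exists (fun z => near (e / 2) (z - x)). split.
    - exists x, e. auto.
    - replace (x - x) with 0 by ring. apply near_zero. lra. }
  intros HA HB. exists (W A B), (W B A).
  repeat split; auto.
  intros z (S & (a & e & Aa & Ka & ->) & Hz) (S' & (b & e' & Bb & Kb & ->) & Hz').
  destruct (Rle_dec e' e).
  - apply (Ka b); [|exact Bb]. apply near_mono with (e / 2 + e' / 2); [lra|].
    eapply near_triangle; [exact Hz|]. now apply near_sym.
  - apply (Kb a); [|exact Aa]. apply near_mono with (e' / 2 + e / 2); [lra|].
    eapply near_triangle; [exact Hz'|]. now apply near_sym.
Qed.

(** * Irrationality of the slope and closed sets of the winding topology *)

(** Infinite descent on the absolute value of [b]: both numbers are even and can be halved. *)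
Lemma double_square_ne_square (b : Z) :
  forall a : Z, (2 * a * a = b * b)%Z -> a = 0%Z.
Proof.
  induction b as [b IH] using (well_founded_induction (Wf_nat.well_founded_ltof _ Z.abs_nat)).
  unfold Wf_nat.ltof in IH.
  intros a H.
  assert (Hb : exists c, (b = 2 * c)%Z).
  { destruct (Z.Even_or_Odd b) as [[c ->]|[c ->]]; [now exists c | exfalso; lia]. }
  destruct Hb as [c ->].
  assert (Ha : exists d, (a = 2 * d)%Z).
  { destruct (Z.Even_or_Odd a) as [[d ->]|[d ->]]; [now exists d | exfalso; lia]. }
  destruct Ha as [d ->].
  destruct (Z.eq_dec c 0) as [->|Hc]; [nia|].
  assert (d = 0)%Z; [apply (IH c); lia | lia].
Qed.

(** Multiplying by the conjugate, which is at most [3 * M + 1] in size, yields the integer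
    [2 * a * a - b * b]; once its absolute value is below 1 it vanishes. *)
Lemma sqrt2_approx_gap (M : R) : 0 <= M -> exists e, 0 < e /\ forall a b : Z,
  Rabs (IZR a) <= M -> Rabs (sqrt 2 * IZR a - IZR b) < e -> (2 * a * a = b * b)%Z.
Proof.
  intros HM. exists (/ (3 * M + 1)).
  assert (Hpos : 0 < / (3 * M + 1)) by (apply Rinv_0_lt_compat; lra).
  split; [exact Hpos|]. intros a b Ha Hab.
  assert (He : / (3 * M + 1) <= 1).
  { rewrite <- Rinv_1 at 2. apply Rinv_le_contravar; lra. }
  assert (Hinv : / (3 * M + 1) * (3 * M + 1) = 1) by (field; lra).
  assert (S := sqrt2_bounds). assert (S2 := sqrt_sqrt 2 ltac:(lra)).
  set (x := sqrt 2 * IZR a - IZR b) in *. set (y := sqrt 2 * IZR a + IZR b).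
  assert (Hy : Rabs y <= 3 * M + 1).
  { replace y with (2 * sqrt 2 * IZR a - x) by (unfold x, y; ring).
    eapply Rle_trans; [apply Rabs_triang|]. rewrite Rabs_Ropp, Rabs_mult.
    rewrite (Rabs_pos_eq (2 * sqrt 2)) by lra.
    assert (0 <= Rabs (IZR a)) by apply Rabs_pos. nra. }
  assert (Hxy : Rabs (x * y) < 1).
  { rewrite Rabs_mult. assert (0 <= Rabs x) by apply Rabs_pos.
    assert (Rabs x * Rabs y <= Rabs x * (3 * M + 1)) by (apply Rmult_le_compat_l; lra).
    assert (Rabs x * (3 * M + 1) < / (3 * M + 1) * (3 * M + 1))
      by (apply Rmult_lt_compat_r; lra). lra. }
  assert (E : x * y = IZR (2 * a * a - b * b)).
  { rewrite minus_IZR, !mult_IZR. unfold x, y.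
    transitivity (sqrt 2 * sqrt 2 * IZR a * IZR a - IZR b * IZR b); [ring|].
    rewrite S2. ring. }
  rewrite E, Rabs_lt_iff in Hxy. destruct Hxy as [H1 H2].
  apply (lt_IZR (-1)) in H1. apply (lt_IZR _ 1) in H2. lia.
Qed.

(** A quantitative form of the injectivity of the winding: a bounded piece of the line comes close
    to the origin of the torus only at small parameters. *)
Lemma near_separates (d M : R) : 0 < d -> exists e, 0 < e /\
  forall u, d <= Rabs u <= M -> ~ near e u.
Proof.
  intros Hd. destruct (Rle_dec d M) as [HdM|HdM].
  2: { exists 1. split; [lra|]. intros u Hu. lra. }
  destruct (sqrt2_approx_gap (M + 1) ltac:(lra)) as (e & He & K).
  (* The bound 1 keeps [p] within [M + 1], [e / 3] absorbs the factor [1 + sqrt 2] and forces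
     [p = 0], and [d] then contradicts the lower bound on [u]. *)
  exists (Rmin (Rmin (e / 3) d) 1). split.
  { repeat apply Rmin_pos; lra. }
  assert (E1 : Rmin (Rmin (e / 3) d) 1 <= 1) by apply Rmin_r.
  assert (E2 : Rmin (Rmin (e / 3) d) 1 <= d)
    by (eapply Rle_trans; [apply Rmin_l | apply Rmin_r]).
  assert (E3 : Rmin (Rmin (e / 3) d) 1 <= e / 3)
    by (eapply Rle_trans; [apply Rmin_l | apply Rmin_l]).
  generalize dependent (Rmin (Rmin (e / 3) d) 1). intros e' E1 E2 E3 u [Hu1 Hu2] (p & q & Hp & Hq).
  assert (S := sqrt2_bounds).
  assert (Hp0 : p = 0%Z).
  { apply (double_square_ne_square q). apply K.
    - replace (IZR p) with (u - (u - IZR p)) by ring.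
      eapply Rle_trans; [apply Rabs_triang|]. rewrite Rabs_Ropp. lra.
    - apply Rabs_lt_iff in Hp, Hq. apply Rabs_lt_iff. split; nra. }
  subst p. rewrite Rminus_0_r in Hp. lra.
Qed.

Lemma compl_interval_winding_open (r : R) : winding_open (fun x => r < Rabs x).
Proof.
  intros x Hx. destruct (near_separates (Rabs x - r) (Rabs x + r) ltac:(lra)) as (e & He & K).
  exists e. split; [exact He|]. intros y Hy. apply Rnot_le_lt. intros Hr.
  apply (K (y - x)); [|exact Hy].
  unfold Rabs in *; repeat destruct Rcase_abs; lra.
Qed.

Lemma compl_point_winding_open (a : R) : winding_open (fun x => x <> a).
Proof.
  intros x Hx.
  destruct (near_separates (Rabs (a - x)) (Rabs (a - x))) as (e & He & K).
  { apply Rabs_pos_lt. lra. }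
  exists e. split; [exact He|]. intros y Hy ->. apply (K (a - x)); [lra | exact Hy].
Qed.

(** * The Pell sequence as a closed discrete set *)

(* The solutions of the Pell equation [p^2 - 8 x^2 = 1], starting at (3, 1). *)
Fixpoint pell (n : nat) : Z * Z :=
  match n with
  | O => (3, 1)%Z
  | S n => let (p, x) := pell n in (3 * p + 8 * x, p + 3 * x)%Z
  end.

Definition pell_p (n : nat) : Z := fst (pell n).
Definition pell_x (n : nat) : Z := snd (pell n).

Lemma pell_S (n : nat) :
  pell_p (S n) = (3 * pell_p n + 8 * pell_x n)%Z /\
  pell_x (S n) = (pell_p n + 3 * pell_x n)%Z.
Proof. unfold pell_p, pell_x. simpl. now destruct (pell n). Qed.

Lemma pell_eq (n : nat) : (pell_p n * pell_p n - 8 * (pell_x n * pell_x n) = 1)%Z.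
Proof. induction n; [reflexivity|]. destruct (pell_S n) as [-> ->]. lia. Qed.

Lemma pell_pos (n : nat) : (0 < pell_p n /\ Z.of_nat n < pell_x n)%Z.
Proof.
  induction n; [split; reflexivity|]. destruct (pell_S n) as [-> ->]. lia.
Qed.

Lemma pell_x_lt (n m : nat) : (n < m)%nat -> (pell_x n < pell_x m)%Z.
Proof.
  induction 1; destruct (pell_S n) as [_ E]; [rewrite E; assert (H := pell_pos n); lia|].
  destruct (pell_S m) as [_ E']. rewrite E'. assert (H' := pell_pos m). lia.
Qed.

Definition spike (n : nat) : R := IZR (pell_x n).

Lemma spike_inj (n m : nat) : spike n = spike m -> n = m.
Proof.
  intros H. apply eq_IZR in H. destruct (Nat.lt_total n m) as [L|[L|L]]; auto;
    apply pell_x_lt in L; lia.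
Qed.

Lemma spike_gt (n : nat) : INR n < spike n.
Proof. rewrite INR_IZR_INZ. apply IZR_lt. apply pell_pos. Qed.

Lemma spike_neq_0 (n : nat) : spike n <> 0.
Proof. assert (H := spike_gt n). assert (H' := pos_INR n). lra. Qed.

(** The Pell equation factors as a product equal to 1, and the conjugate factor exceeds [/ e] for
    large [n]. *)
Lemma pell_approx (e : R) : 0 < e -> exists K, forall n, (K <= n)%nat ->
  Rabs (2 * sqrt 2 * spike n - IZR (pell_p n)) < e.
Proof.
  intros He. destruct (INR_unbounded (/ e)) as [K HK]. exists K. intros n Hn.
  assert (S := sqrt2_bounds). assert (S2 := sqrt_sqrt 2 ltac:(lra)).
  assert (Hx := spike_gt n). apply le_INR in Hn.
  assert (Hp : 0 < IZR (pell_p n)) by (apply IZR_lt; apply pell_pos).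
  assert (E : IZR (pell_p n) * IZR (pell_p n) - 8 * (spike n * spike n) = 1).
  { unfold spike. rewrite <- !mult_IZR, <- minus_IZR. now rewrite pell_eq. }
  set (p := IZR (pell_p n)) in *. set (x := spike n) in *.
  assert (E' : (p - 2 * sqrt 2 * x) * (p + 2 * sqrt 2 * x) = 1).
  { rewrite <- E. replace 8 with (4 * (sqrt 2 * sqrt 2)) by lra. ring. }
  assert (Hi : 0 < / e) by now apply Rinv_0_lt_compat.
  assert (Hsum : / e < p + 2 * sqrt 2 * x) by nra.
  assert (Hie : e * / e = 1) by (field; lra).
  rewrite Rabs_lt_iff. split; nra.
Qed.

(* The fractional parts of [spike n] and [sqrt 2 * spike n] tend to 0 and 1/2,
   and no real number has exactly these fractional parts. *)
Lemma spike_no_limit (t : R) : exists e K, 0 < e /\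
  forall n, (K <= n)%nat -> ~ near e (spike n - t).
Proof.
  assert (HM : 0 <= 2 * (Rabs t + 1)) by (assert (H := Rabs_pos t); lra).
  destruct (sqrt2_approx_gap _ HM) as (e & He & G).
  assert (Hm : 0 < Rmin (e / 10) 1) by (apply Rmin_pos; lra).
  assert (E1 : Rmin (e / 10) 1 <= 1) by apply Rmin_r.
  assert (E2 : Rmin (e / 10) 1 <= e / 10) by apply Rmin_l.
  generalize dependent (Rmin (e / 10) 1). intros d Hd E1 E2.
  destruct (pell_approx d Hd) as (K & HK).
  exists d, K. split; [exact Hd|]. intros n Hn (p & q & Hp & Hq).
  specialize (HK n Hn). assert (S := sqrt2_bounds).
  (* This equality makes [pell_p n] even, whereas the Pell equation makes it odd. *)
  assert (E : (2 * (2 * (pell_x n - p)) * (2 * (pell_x n - p))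
              = (pell_p n - 2 * q) * (pell_p n - 2 * q))%Z).
  { apply G; rewrite ?mult_IZR, ?minus_IZR, ?mult_IZR; fold (spike n).
    - rewrite Rabs_mult, (Rabs_pos_eq 2) by lra. apply Rmult_le_compat_l; [lra|].
      unfold Rabs in *; repeat destruct Rcase_abs; lra.
    - apply Rabs_lt_iff in Hq, HK. apply Rabs_lt_iff in Hp. apply Rabs_lt_iff. split; nra. }
  assert (P := pell_eq n).
  set (p' := pell_p n) in *. set (x' := pell_x n) in *.
  destruct (Z.Even_or_Odd p') as [[c Hc]|[c Hc]]; rewrite Hc in *; lia.
Qed.

(** [spike_no_limit] handles the tail of the sequence; the finitely many earlier spikes are avoided
    one at a time. *)
Lemma compl_spikes_winding_open (S : nat -> Prop) :
  winding_open (fun x => forall n, S n -> x <> spike n).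
Proof.
  intros t Ht. destruct (spike_no_limit t) as (e & K & He & HK).
  assert (L : forall K, exists e, 0 < e /\
    forall n, (n < K)%nat -> S n -> ~ near e (spike n - t)).
  { clear - Ht. induction K as [|K (e & He & IH)].
    - exists 1. split; [lra|]. lia.
    - destruct (classic (S K)) as [HS|HS].
      + destruct (compl_point_winding_open (spike K) t (Ht K HS)) as (e' & He' & H).
        exists (Rmin e e'). split; [now apply Rmin_pos|].
        intros n Hn Sn Hnear. assert (n = K \/ n < K)%nat as [->|Hlt] by lia.
        * apply (H (spike K)); [|reflexivity].
          eapply near_mono; [apply Rmin_r | exact Hnear].
        * apply (IH n Hlt Sn). eapply near_mono; [apply Rmin_l | exact Hnear].
      + exists e. split; [exact He|]. intros n Hn Sn.
        assert (n = K \/ n < K)%nat as [->|Hlt] by lia; [contradiction | auto]. }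
  destruct (L K) as (e' & He' & HK').
  exists (Rmin e e'). split; [now apply Rmin_pos|].
  intros y Hy n Sn ->. destruct (le_lt_dec K n) as [Hn|Hn].
  - apply (HK n Hn). eapply near_mono; [apply Rmin_l | exact Hy].
  - apply (HK' n Hn Sn). eapply near_mono; [apply Rmin_r | exact Hy].
Qed.

(** * Topologies defined by free filters *)

Definition is_free_filter (F : (nat -> Prop) -> Prop) : Prop :=
  (forall m, F (fun n => n <> m)) /\
  (forall S S' : nat -> Prop, (forall n, S n -> S' n) -> F S -> F S') /\
  (forall S S', F S -> F S' -> F (fun n => S n /\ S' n)).

(** A coarsening of the winding topology in which the spikes converge to 0 along [F]; points other
    than 0 keep their small neighbourhoods. *)
Definition spike_topology (F : (nat -> Prop) -> Prop) (U : R -> Prop) : Prop :=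
  winding_open U /\ (U 0 -> F (fun n => U (spike n))).

Lemma spike_topology_off_0 (F : (nat -> Prop) -> Prop) (U : R -> Prop) :
  winding_open U -> ~ U 0 -> spike_topology F U.
Proof. split; [assumption | contradiction]. Qed.

Lemma spike_topology_is_topology (F : (nat -> Prop) -> Prop) :
  is_free_filter F -> is_topology (spike_topology F).
Proof.
  intros (Fp & Fup & Fint). repeat split; try tauto.
  - intros x [].
  - intros x _. exists 1. split; [lra | auto].
  - intros _. apply Fup with (fun n => n <> O); auto.
  - apply winding_open_union. intros V HV. now apply H.
  - intros (V & FV & V0). apply Fup with (fun n => V (spike n)); [eauto|].
    now apply (H V FV).
  - apply winding_open_inter; [apply H | apply H0].
  - intros [U0 V0]. apply Fint; [now apply H | now apply H0].
Qed.

Lemma spike_topology_T1 (F : (nat -> Prop) -> Prop) (a : R) :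
  is_free_filter F -> spike_topology F (fun x => x <> a).
Proof.
  intros (Fp & Fup & _). split; [apply compl_point_winding_open|]. intros _.
  destruct (classic (exists m, spike m = a)) as [[m <-]|H].
  - apply Fup with (fun n => n <> m); [|apply Fp]. intros n Hn E. now apply Hn, spike_inj.
  - apply Fup with (fun n => n <> O); [|apply Fp]. intros n _ E. apply H. now exists n.
Qed.

Lemma not_closure (tau : (R -> Prop) -> Prop) (A : R -> Prop) (x : R) :
  ~ closure tau A x -> exists U, tau U /\ U x /\ forall y, U y -> ~ A y.
Proof.
  intros H. apply NNPP. intros K. apply H. intros U HU Ux. apply NNPP. intros N.
  apply K. exists U. repeat split; auto. intros y Uy Ay. apply N. now exists y.
Qed.

(* Adding to A the spikes of a set in F that witnesses [0] being outside the
   closure of B keeps the pair separated and makes every open superset of A a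
   neighbourhood of 0. *)
Lemma spike_separation (F : (nat -> Prop) -> Prop) (A B : R -> Prop) :
  is_free_filter F -> ~ B 0 ->
  (forall x, closure (spike_topology F) A x -> B x -> False) ->
  (forall x, A x -> closure (spike_topology F) B x -> False) ->
  exists U V, spike_topology F U /\ spike_topology F V /\
    (forall x, A x -> U x) /\ (forall x, B x -> V x) /\
    (forall z, U z -> V z -> False).
Proof.
  intros (Fp & Fup & Fint) B0 HA HB.
  assert (HS : exists S : nat -> Prop, (A 0 -> F S) /\
    forall n, S n -> exists W, winding_open W /\ W (spike n) /\ forall y, W y -> ~ B y).
  { destruct (classic (A 0)) as [A0|A0].
    - destruct (not_closure _ _ _ (HB 0 A0)) as (W & [HW HF] & W0 & K).
      exists (fun n => W (spike n)). split; [auto|]. intros n Hn. now exists W.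
    - exists (fun _ => False). tauto. }
  destruct HS as (S & FS & HS).
  destruct (winding_separation
    (fun x => A x \/ exists n, S n /\ x = spike n) B) as (U & V & HU & HV & AU & BV & D).
  - intros a Ha.
    assert (exists W, winding_open W /\ W a /\ forall y, W y -> ~ B y) as (W & HW & Wa & K).
    { destruct Ha as [Ha|(n & Sn & ->)]; [|now apply HS].
      destruct (not_closure _ _ _ (HB a Ha)) as (W & [HW _] & Wa & K). now exists W. }
    destruct (HW a Wa) as (e & He & L). exists e. split; [exact He|]. auto.
  - intros b Bb.
    (* The neighbourhood of [b] must also avoid the added spikes. They form a closed set, and [b] is
       none of them because each has a neighbourhood off B. *)
    destruct (not_closure (spike_topology F) A b) as (W & [HW _] & Wb & K); [eauto|].
    destruct (winding_open_inter _ _ HW (compl_spikes_winding_open S) b) as (e & He & L).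
    { split; [exact Wb|]. intros n Sn ->. destruct (HS n Sn) as (W' & _ & H1 & H2).
      now apply (H2 (spike n)). }
    exists e. split; [exact He|]. intros a Ha [Aa|(n & Sn & ->)].
    + apply (K a); [now apply L | exact Aa].
    + now apply (proj2 (L _ Ha) n).
  - destruct (classic (A 0)) as [A0|A0].
    + exists U, V. repeat split; auto.
      * intros _. apply Fup with S; [|auto]. intros n Sn. apply AU. eauto.
      * intros V0. exfalso. eapply D; eauto.
    (* Here 0 lies in neither A nor B, so it can be deleted from both sets, which makes the filter
       condition vacuous. *)
    + exists (fun x => U x /\ x <> 0), (fun x => V x /\ x <> 0).
      assert (O := compl_point_winding_open 0).
      split; [apply spike_topology_off_0; [now apply winding_open_inter | tauto]|].
      split; [apply spike_topology_off_0; [now apply winding_open_inter | tauto]|].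
      repeat split; auto; try congruence.
      intros z [] []. eauto.
Qed.

(** At most one of the two sets contains 0, so [spike_separation] applies after a swap if
    necessary. *)
Lemma spike_topology_completely_normal (F : (nat -> Prop) -> Prop) :
  is_free_filter F -> completely_normal (spike_topology F).
Proof.
  intros HF A B HA HB. destruct (classic (B 0)) as [B0|B0].
  - destruct (spike_separation F B A) as (U & V & HU & HV & BU & AV & D); eauto.
    + intros A0. apply (HA 0); [|exact B0]. intros W _ W0. eauto.
    + exists V, U. repeat split; eauto; [apply HV | apply HV | apply HU | apply HU].
  - now apply spike_separation.
Qed.

Lemma hausdorff_of_completely_normal (tau : (R -> Prop) -> Prop) :
  completely_normal tau -> (forall a, tau (fun x => x <> a)) -> hausdorff tau.
Proof.
  intros CN T1 x y Hxy.
  destruct (CN (fun z => z = x) (fun z => z = y)) as (U & V & HU & HV & xU & yV & D).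
  - intros z Hz ->. destruct (Hz _ (T1 x)) as (z & H & H'); [congruence | contradiction].
  - intros z -> Hz. destruct (Hz _ (T1 y)) as (z & H & H'); [congruence | contradiction].
  - exists U, V. repeat split; auto.
Qed.

(** Translation by [2 * spike n] fixes the first torus coordinate exactly and, by [pell_approx], the
    second one nearly. *)
Lemma winding_recurrence (e r x : R) : 0 < e -> exists y, near e (y - x) /\ r < Rabs y.
Proof.
  intros He. destruct (pell_approx e He) as (K & HK).
  destruct (INR_unbounded (r + Rabs x)) as (K' & HK').
  set (n := max K K').
  exists (x + 2 * spike n). split.
  - replace (x + 2 * spike n - x) with (2 * spike n) by ring.
    exists (2 * pell_x n)%Z, (pell_p n). split.
    + rewrite mult_IZR. unfold spike. rewrite Rminus_diag. now rewrite Rabs_R0.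
    + replace (sqrt 2 * (2 * spike n)) with (2 * sqrt 2 * spike n) by ring.
      apply HK. apply Nat.le_max_l.
  - assert (H := spike_gt n).
    assert (INR K' <= INR n) by (apply le_INR, Nat.le_max_r).
    assert (0 <= INR K') by apply pos_INR.
    unfold Rabs in *; repeat destruct Rcase_abs; lra.
Qed.

Lemma spike_topology_first_category (F : (nat -> Prop) -> Prop) :
  first_category (spike_topology F).
Proof.
  exists (fun n x => Rabs x <= INR n). split.
  - intros n x (U & [HU _] & Ux & K).
    destruct (HU x Ux) as (e & He & L).
    destruct (winding_recurrence e (INR n) x He) as (y & Hy & Hr).
    (* The complement of the interval misses 0, hence is open whatever [F] is, so [y] cannot lie in
       the closure. *)
    destruct (K y (L y Hy) (fun x => INR n < Rabs x)) as (z & Hz & Hz').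
    + apply spike_topology_off_0; [apply compl_interval_winding_open|].
      rewrite Rabs_R0. assert (H := pos_INR n). lra.
    + exact Hr.
    + lra.
  - intros x. destruct (INR_unbounded (Rabs x)) as (n & Hn). exists n. lra.
Qed.

Lemma spike_topology_in_L (F : (nat -> Prop) -> Prop) :
  is_free_filter F -> in_L (spike_topology F).
Proof.
  intros HF. split; [now apply spike_topology_is_topology|]. split.
  - apply hausdorff_of_completely_normal.
    + now apply spike_topology_completely_normal.
    + intros a. now apply spike_topology_T1.
  - intros U [HU _]. now apply winding_open_euclid.
Qed.

(** Deleting the spikes with index outside [S] leaves a winding-open set around 0 that is open for a
    filter exactly when [S] belongs to it. *)
Lemma spike_topology_inj (F F' : (nat -> Prop) -> Prop) (S : nat -> Prop) :
  is_free_filter F -> is_free_filter F' -> (forall U, spike_topology F U -> spike_topology F' U) ->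
  F S -> F' S.
Proof.
  intros (_ & Fup & _) (_ & Fup' & _) H FS.
  set (U := fun x => forall n, ~ S n -> x <> spike n).
  assert (HU : spike_topology F U).
  { split; [apply compl_spikes_winding_open|]. intros _.
    apply Fup with S; [|exact FS]. intros n Sn m Sm E. apply spike_inj in E. congruence. }
  apply H in HU. destruct HU as [_ HU].
  apply Fup' with (fun n => U (spike n)).
  - intros n Hn. apply NNPP. intros Sn. now apply (Hn n).
  - apply HU. intros n _ E. symmetry in E. now apply spike_neq_0 in E.
Qed.

(** * Almost disjoint branches and the filters they generate *)

(** The first [n] bits are read in binary after a leading 1, so that the code also determines the
    length. *)
Fixpoint prefix_code (b : nat -> bool) (n : nat) : nat :=
  match n with
  | O => 1
  | S n => 2 * prefix_code b n + Nat.b2n (b n)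
  end.

Lemma prefix_code_gt (b : nat -> bool) (n : nat) : (n < prefix_code b n)%nat.
Proof. induction n; simpl; lia. Qed.

Lemma prefix_code_inj (b b' : nat -> bool) (n n' : nat) :
  prefix_code b n = prefix_code b' n' -> forall i, (i < n)%nat -> b i = b' i.
Proof.
  revert n'. induction n as [|n IH]; intros [|n'] H i Hi; try lia.
  - simpl in H. assert (G := prefix_code_gt b n). lia.
  - simpl in H.
    assert (prefix_code b n = prefix_code b' n' /\ b n = b' n') as [H1 H2].
    { destruct (b n), (b' n'); simpl in H; split; try reflexivity; lia. }
    assert (n = n').
    { clear - H1. revert n' H1. induction n as [|n IH]; intros [|n'] H; try reflexivity.
      - simpl in H. assert (G := prefix_code_gt b' n'). lia.
      - simpl in H. assert (G := prefix_code_gt b n). lia.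
      - f_equal. apply IH. simpl in H. destruct (b n), (b' n'); simpl in H; lia. }
    subst n'. assert (i = n \/ i < n)%nat as [->|Hlt] by lia; [exact H2|].
    now apply (IH n).
Qed.

Definition branch (b : nat -> bool) (k : nat) : Prop := exists n, k = prefix_code b n.

Lemma branch_almost_disjoint (b b' : nat -> bool) :
  b <> b' -> exists N, forall n, (N <= n)%nat -> ~ branch b' (prefix_code b n).
Proof.
  intros H. assert (exists i, b i <> b' i) as [i Hi].
  { apply NNPP. intros K. apply H. extensionality i. apply NNPP. eauto. }
  exists (S i). intros n Hn (n' & E). apply Hi. eapply prefix_code_inj; eauto.
Qed.

(** The filter generated by the cofinite sets and the complements of the branches in [G]. *)
Definition branch_filter (G : (nat -> bool) -> Prop) (S : nat -> Prop) : Prop :=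
  exists (L : list (nat -> bool)) (m : nat), (forall b, In b L -> G b) /\
    forall k, (m <= k)%nat -> (forall b, In b L -> ~ branch b k) -> S k.

Lemma branch_filter_is_free_filter (G : (nat -> bool) -> Prop) : is_free_filter (branch_filter G).
Proof.
  repeat split.
  - intros m. exists nil, (S m). split; [intros b []|]. intros k Hk _. lia.
  - intros S S' H (L & m & HL & K). exists L, m. auto.
  - intros S S' (L & m & HL & K) (L' & m' & HL' & K'). exists (L ++ L'), (max m m').
    split.
    + intros b Hb. apply in_app_or in Hb. destruct Hb; auto.
    + intros k Hk Hb. split; [apply K | apply K']; try lia;
        intros b Ib; apply Hb; apply in_or_app; auto.
Qed.

(** The filter determines [G]: finitely many other branches cover only finitely many nodes of the
    branch of [b]. *)
Lemma branch_filter_compl (G : (nat -> bool) -> Prop) (b : nat -> bool) :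
  branch_filter G (fun k => ~ branch b k) <-> G b.
Proof.
  split.
  - intros (L & m & HL & K). apply NNPP. intros NG.
    assert (A : exists N, forall n, (N <= n)%nat ->
      forall b', In b' L -> ~ branch b' (prefix_code b n)).
    { clear K. induction L as [|c L IH].
      - exists O. intros n _ b' [].
      - destruct IH as [N HN]; [intros; apply HL; now right|].
        destruct (branch_almost_disjoint b c) as [N' HN'].
        { intros ->. apply NG, HL. now left. }
        exists (max N N'). intros n Hn b' [<-|Hb'].
        + apply HN'. lia.
        + apply HN; [lia | exact Hb']. }
    destruct A as [N HN].
    apply (K (prefix_code b (max N m))).
    + assert (H := prefix_code_gt b (max N m)). lia.
    + apply HN. lia.
    + now eexists.
  - intros Gb. exists (b :: nil), O. split.
    + intros b' [<-|[]]. exact Gb.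
    + intros k _ H. apply H. now left.
Qed.

(** * The rationals, and coding sequences of reals by bits *)

Definition dense_seq (n : nat) : R :=
  let (k, c) := Cantor.of_nat n in
  let (a, b) := Cantor.of_nat k in (INR a - INR b) / INR (S c).

Lemma dense_seq_dense (x y : R) : x < y -> exists n, x < dense_seq n < y.
Proof.
  intros H. destruct (INR_unbounded (/ (y - x))) as (c & Hc).
  assert (Hd : 0 < / (y - x)) by (apply Rinv_0_lt_compat; lra).
  assert (Hc' : 0 < INR (S c)) by (apply lt_0_INR; lia).
  (* The least integer above [x * INR (S c)] gives a fraction exceeding [x] by at most
     [/ INR (S c)], which is less than [y - x]. *)
  set (z := up (x * INR (S c))).
  destruct (archimed (x * INR (S c))) as [H1 H2]. fold z in H1, H2.
  exists (Cantor.to_nat (Cantor.to_nat (Z.to_nat z, Z.to_nat (- z)), c)).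
  unfold dense_seq. rewrite !Cantor.cancel_of_to.
  replace (INR (Z.to_nat z) - INR (Z.to_nat (- z))) with (IZR z).
  2: { rewrite !INR_IZR_INZ, <- minus_IZR. f_equal. lia. }
  assert (E : IZR z / INR (S c) * INR (S c) = IZR z) by (field; lra).
  assert (1 < (y - x) * INR (S c)).
  { rewrite S_INR in *. assert ((y - x) * / (y - x) = 1) by (field; lra). nra. }
  split; apply Rmult_lt_reg_r with (INR (S c)); lra.
Qed.

(** The Dedekind cuts of all terms, interleaved by Cantor pairing, embed the real sequences into the
    binary ones. *)
Definition cut_code (a : nat -> R) (k : nat) : bool :=
  let (n, m) := Cantor.of_nat k in
  if Rlt_dec (dense_seq m) (a n) then true else false.

Lemma cut_code_inj (a a' : nat -> R) : cut_code a = cut_code a' -> a = a'.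
Proof.
  intros H. extensionality n.
  assert (L : forall a a', cut_code a = cut_code a' -> ~ a n < a' n).
  { clear. intros a a' H Hlt. destruct (dense_seq_dense _ _ Hlt) as (m & H1 & H2).
    apply (f_equal (fun c => c (Cantor.to_nat (n, m)))) in H.
    unfold cut_code in H. rewrite Cantor.cancel_of_to in H.
    destruct Rlt_dec in H; destruct Rlt_dec in H; try discriminate; lra. }
  assert (L1 := L a a' H). assert (L2 := L a' a (eq_sym H)). lra.
Qed.

(** * Homeomorphism classes *)

Definition homeo (tau1 tau2 : (R -> Prop) -> Prop) (f g : R -> R) : Prop :=
  (forall x, g (f x) = x) /\ (forall y, f (g y) = y) /\
  (forall U, tau2 U -> tau1 (fun x => U (f x))) /\
  (forall U, tau1 U -> tau2 (fun y => U (g y))).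

Lemma homeomorphic_refl (tau : (R -> Prop) -> Prop) : homeomorphic tau tau.
Proof. exists (fun x => x), (fun x => x). auto. Qed.

Lemma homeomorphic_sym (tau1 tau2 : (R -> Prop) -> Prop) :
  homeomorphic tau1 tau2 -> homeomorphic tau2 tau1.
Proof. intros (f & g & H1 & H2 & H3 & H4). now exists g, f. Qed.

Lemma homeomorphic_trans (tau1 tau2 tau3 : (R -> Prop) -> Prop) :
  homeomorphic tau1 tau2 -> homeomorphic tau2 tau3 -> homeomorphic tau1 tau3.
Proof.
  intros (f & g & H1 & H2 & H3 & H4) (f' & g' & H1' & H2' & H3' & H4').
  exists (fun x => f' (f x)), (fun x => g (g' x)). repeat split.
  - intros x. now rewrite H1'.
  - intros x. now rewrite H2.
  - intros U HU. apply (H3 (fun x => U (f' x))). auto.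
  - intros U HU. apply (H4' (fun x => U (g x))). auto.
Qed.

(** A choice depending only on the class, since homeomorphic topologies yield the same predicate;
    [euclid_open] only shows the type inhabited. *)
Definition representative (tau : (R -> Prop) -> Prop) : (R -> Prop) -> Prop :=
  epsilon (inhabits euclid_open) (homeomorphic tau).

Lemma representative_homeomorphic (tau : (R -> Prop) -> Prop) :
  homeomorphic tau (representative tau).
Proof. apply (epsilon_spec _ (homeomorphic tau)). exists tau. apply homeomorphic_refl. Qed.

Lemma representative_eq (tau1 tau2 : (R -> Prop) -> Prop) :
  homeomorphic tau1 tau2 -> representative tau1 = representative tau2.
Proof.
  intros H. unfold representative.
  assert (E : homeomorphic tau1 = homeomorphic tau2).
  { extensionality s. apply propositional_extensionality. split; intros K.
    - eapply homeomorphic_trans; [apply homeomorphic_sym, H | exact K].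
    - eapply homeomorphic_trans; eauto. }
  now rewrite E.
Qed.

(* A continuous map from the Euclidean line to a Hausdorff space is determined by its
   values on a dense sequence, and the homeomorphism determines its source topology. *)
Lemma homeo_determined (tau1 tau2 sigma : (R -> Prop) -> Prop) (f1 g1 f2 g2 : R -> R) :
  hausdorff tau1 -> coarser tau1 euclid_open -> coarser tau2 euclid_open ->
  homeo tau1 sigma f1 g1 -> homeo tau2 sigma f2 g2 ->
  (forall n, f1 (dense_seq n) = f2 (dense_seq n)) ->
  forall U, tau1 U -> tau2 U.
Proof.
  intros T2 C1 C2 (G1 & F1 & I1 & O1) (G2 & F2 & I2 & O2) E.
  assert (EQ : forall x, f1 x = f2 x).
  { intros x. apply NNPP. intros N.
    (* Pulling [f2 x] back by [g1] moves the comparison into [tau1], where the Hausdorff property is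
       available. *)
    destruct (T2 x (g1 (f2 x))) as (U & V & HU & HV & Ux & Vx & D).
    { intros K. apply N. rewrite K at 1. apply F1. }
    assert (OU := C1 _ (I1 _ (O1 _ HU))). assert (OV := C2 _ (I2 _ (O1 _ HV))).
    destruct (OU x) as (e & He & K); [simpl; now rewrite G1|].
    destruct (OV x Vx) as (e' & He' & K').
    assert (Hm := Rmin_pos _ _ He He').
    assert (M1 := Rmin_l e e'). assert (M2 := Rmin_r e e').
    destruct (dense_seq_dense x (x + Rmin e e')) as (n & Hn); [lra|].
    apply (D (g1 (f1 (dense_seq n)))).
    - apply K. rewrite Rabs_lt_iff. lra.
    - rewrite E. apply K'. rewrite Rabs_lt_iff. lra. }
  intros U HU. apply O1, I2 in HU.
  replace U with (fun x => U (g1 (f2 x))); [exact HU|].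
  extensionality x. now rewrite <- EQ, G1.
Qed.

(** * Diagonalization and the final family *)

(* König's argument: a point missing from every [i]-th projection would give a
   function lying in no [C i]. *)
Lemma cover_of_power_has_onto_projection (I P : Type) (C : I -> (I -> P) -> Prop) :
  (forall h, exists i, C i h) -> exists i, forall p, exists h, C i h /\ h i = p.
Proof.
  intros H. apply NNPP. intros N.
  assert (K : forall i, exists p, forall h, C i h -> h i <> p).
  { intros i. apply NNPP. intros M. apply N. exists i. intros p. apply NNPP. intros Q.
    apply M. exists p. intros h Ch E. apply Q. now exists h. }
  destruct (H (fun i => proj1_sig (constructive_indefinite_description _ (K i))))
    as [i Hi].
  exact (proj2_sig (constructive_indefinite_description _ (K i)) _ Hi eq_refl).
Qed.

(** A relation between sequences and reals becomes a set of branches by putting the real in front of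
    the sequence. *)
Definition code_set (h : (nat -> R) -> R -> Prop) (b : nat -> bool) : Prop :=
  exists a, cut_code a = b /\ h (fun n => a (S n)) (a O).

Lemma code_set_cons (h : (nat -> R) -> R -> Prop) (j : nat -> R) (r : R) :
  code_set h (cut_code (fun n => match n with O => r | S n => j n end)) <-> h j r.
Proof.
  split.
  - intros (a & E & H). apply cut_code_inj in E. now subst a.
  - intros H. now exists (fun n => match n with O => r | S n => j n end).
Qed.

Definition space (h : (nat -> R) -> R -> Prop) : (R -> Prop) -> Prop :=
  spike_topology (branch_filter (code_set h)).

Lemma space_inj (h h' : (nat -> R) -> R -> Prop) (j : nat -> R) (r : R) :
  (forall U, space h U -> space h' U) -> h j r -> h' j r.
Proof.
  intros H. rewrite <- !code_set_cons, <- !branch_filter_compl.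
  apply spike_topology_inj; auto using branch_filter_is_free_filter.
Qed.

(* A family of topologies indexed by the power set of R (cardinality 2^c),
   pairwise non-homeomorphic for distinct indices. *)
Theorem theorem5 :
  exists T : (R -> Prop) -> ((R -> Prop) -> Prop),
    (forall A, in_L (T A) /\ completely_normal (T A) /\ first_category (T A)) /\
    (forall A B, (exists x, ~ (A x <-> B x)) -> ~ homeomorphic (T A) (T B)).
Proof.
  (* The cover sorts each [h] by the values on [dense_seq] of a homeomorphism onto the
     representative. For one such trace [j], the sets [h j] exhaust all subsets of the line. *)
  destruct (cover_of_power_has_onto_projection (nat -> R) (R -> Prop)
    (fun j h => exists f g, homeo (space h) (representative (space h)) f g /\
       forall n, f (dense_seq n) = j n)) as [j Hj].
  { intros h. destruct (representative_homeomorphic (space h)) as (f & g & H).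
    exists (fun n => f (dense_seq n)), f, g. now split. }
  assert (L : forall h, in_L (space h)).
  { intros h. apply spike_topology_in_L, branch_filter_is_free_filter. }
  set (pick A := constructive_indefinite_description _ (Hj A)).
  exists (fun A => space (proj1_sig (pick A))). split.
  - intros A. split; [apply L|]. split.
    + apply spike_topology_completely_normal, branch_filter_is_free_filter.
    + apply spike_topology_first_category.
  - assert (K : forall A B, homeomorphic (space (proj1_sig (pick A))) (space (proj1_sig (pick B)))
      -> forall x, A x -> B x).
    { intros A B H x.
      destruct (pick A) as (h & (f & g & Hfg & Hn) & <-).
      destruct (pick B) as (h' & (f' & g' & Hfg' & Hn') & <-). simpl in H.
      (* Both homeomorphisms now have the same target and the same trace [j], so the first topology
         is contained in the second. *)
      rewrite <- (representative_eq _ _ H) in Hfg'.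
      apply space_inj. eapply homeo_determined; try eassumption; try apply L.
      intros n. now rewrite Hn, Hn'. }
    intros A B (x & Hx) H. apply Hx. split; apply K; auto using homeomorphic_sym.
Qed.
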